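(* Every monomorphism in $\mathsf{ICM}$ (as a category with homomorphisms of implicitly closed meadows as arrows) is regular. Equivalently, for all $\mathbf A\le\mathbf B\in\mathsf{ICM}$ one has $\mathsf d_{\mathsf{ICM}}(\mathbf A,\mathbf B)=A$.
   Context: A field is weakly rooted if it has characteristic $0$, or has prime characteristic $p$ and every element has a $p$-th root. Weak inverse: $a^*=a^{-1}$ if $a\ne0$, $0^*=0$. Weak $p$-root (in a weakly rooted field, $p$ prime): $r_p(a)=\sqrt[p]{a}$ if the characteristic is $p$, and $0$ otherwise. An implicitly closed field is a weakly rooted field (in the ring language $\{+,\cdot,-,0,1\}$) expanded by $(\,)^*$ and all $r_p$; $\mathsf{ICM}$ is the class of algebras in the resulting language isomorphic to subalgebras of direct products of implicitly closed fields. A monomorphism is regular if it is an equalizer of a parallel pair. For a class $\mathsf K$ of similar algebras and $\mathbf A\le\mathbf B\in\mathsf K$, the dominion $\mathsf d_{\mathsf K}(\mathbf A,\mathbf B)$ is the set of $b\in B$ such that $g(b)=h(b)$ for all pairs of homomorphisms $g,h:\mathbf B\to\mathbf C$ with $\mathbf C\in\mathsf K$ and $g{\restriction}_A=h{\restriction}_A$. *)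

(* Defs.v *)
From HB Require Import structures.
From mathcomp Require Import all_boot all_order all_algebra.
Set Implicit Arguments. Unset Strict Implicit. Unset Printing Implicit Defensive.
Import GRing.Theory.
Local Open Scope ring_scope.

(* Algebras in the language {+, ., -, 0, 1, ( )^*, r_p (p prime)}.
   The family of weak p-roots is indexed by nat; only the indices p with
   [prime p] belong to the language (non-prime indices are ignored by
   homomorphisms, subalgebras and the class ICM). *)
Record alg := Alg {
  car :> Type;
  aadd : car -> car -> car;
  amul : car -> car -> car;
  aopp : car -> car;
  azero : car;
  aone : car;
  ainv : car -> car;
  aroot : nat -> car -> car
}.

Definition is_hom (A B : alg) (f : A -> B) : Prop :=
  (((forall x y, f (aadd x y) = aadd (f x) (f y))) /\
      ((forall x y, f (amul x y) = amul (f x) (f y))) /\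
      ((forall x, f (aopp x) = aopp (f x))) /\
      (f (azero A) = azero B) /\
      (f (aone A) = aone B) /\
      ((forall x, f (ainv x) = ainv (f x)) /\
      (forall p, prime p -> forall x, f (aroot p x) = aroot p (f x)))).

Definition weakly_rooted (F : fieldType) : Prop :=
  [pchar F] =i pred0 \/
  exists p, p \in [pchar F] /\ forall a : F, exists b : F, b ^+ p = a.

(* ICM: A is isomorphic to a subalgebra of a direct product of implicitly
   closed fields, i.e. there is an injective homomorphism of A into a product
   prod_{i in I} F_i of weakly rooted fields, each expanded by the weak inverse
   (x^* = x^-1, 0^* = 0, which is mathcomp's field inverse) and the weak
   p-roots r_p (r_p(a) = the (unique) p-th root of a if char F_i = p, and 0
   otherwise); the product operations are pointwise. *)
Definition ICM (A : alg) : Prop :=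
  exists (I : Type) (F : I -> fieldType) (f : A -> forall i, F i),
    (((forall i, weakly_rooted (F i))) /\
      (injective f) /\
      ((forall x y i, f (aadd x y) i = f x i + f y i)) /\
      ((forall x y i, f (amul x y) i = f x i * f y i)) /\
      ((forall x i, f (aopp x) i = - f x i)) /\
      ((forall i, f (azero A) i = 0)) /\
      ((forall i, f (aone A) i = 1)) /\
      ((forall x i, f (ainv x) i = (f x i)^-1) /\
        (forall p, prime p -> forall x i,
           (p \in [pchar (F i)] -> (f (aroot p x) i) ^+ p = f x i) /\
           (p \notin [pchar (F i)] -> f (aroot p x) i = 0)))).

Definition ICM_mono (A B : alg) (f : A -> B) : Prop :=
  is_hom f /\
  forall (C : alg) (g h : C -> A), ICM C -> is_hom g -> is_hom h ->
    (forall c, f (g c) = f (h c)) -> forall c, g c = h c.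

Definition ICM_equalizer (A B D : alg) (f : A -> B) (u v : B -> D) : Prop :=
  (forall a, u (f a) = v (f a)) /\
  forall (C : alg) (g : C -> B), ICM C -> is_hom g ->
    (forall c, u (g c) = v (g c)) ->
    exists k : C -> A, [/\ is_hom k, (forall c, f (k c) = g c) &
       forall k' : C -> A, is_hom k' -> (forall c, f (k' c) = g c) ->
         forall c, k' c = k c].

Definition ICM_regular_mono (A B : alg) (f : A -> B) : Prop :=
  is_hom f /\
  exists (D : alg) (u v : B -> D),
    ((ICM D) /\
      (is_hom u) /\
      (is_hom v) /\
      (ICM_equalizer f u v)).

Definition is_subuniverse (B : alg) (S : B -> Prop) : Prop :=
  (((forall x y, S x -> S y -> S (aadd x y))) /\
      ((forall x y, S x -> S y -> S (amul x y))) /\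
      ((forall x, S x -> S (aopp x))) /\
      (S (azero B)) /\
      (S (aone B)) /\
      ((forall x, S x -> S (ainv x)) /\
      (forall p, prime p -> forall x, S x -> S (aroot p x)))).

Definition ICM_dominion (B : alg) (S : B -> Prop) (b : B) : Prop :=
  forall (C : alg) (g h : B -> C), ICM C -> is_hom g -> is_hom h ->
    (forall a, S a -> g a = h a) -> g b = h b.

(* Main.v *)
Require Import Defs.
From HB Require Import structures.
From mathcomp Require Import all_boot all_order all_algebra.
From mathcomp Require Import generic_quotient.
From mathcomp Require Import boolp classical_sets.
From mathcomp Require Import ring.

(** Let [S] be a subalgebra of [B] and [b] outside [S].  Zorn's lemma gives an
    ideal [N] of [B] maximal among those disjoint from [b - S].  As [B] is von
    Neumann regular, [Q = B / N] is reduced and the image [K] of [S] in [Q] is a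
    perfect field which does not contain the image of [b].  In [Q (x)_K Q] the
    element [d = 1 (x) b - b (x) 1] is then not nilpotent: in characteristic [p]
    because [d ^ (p ^ n) = 1 (x) b ^ (p ^ n) - b ^ (p ^ n) (x) 1], and in
    characteristic [0] because nilpotence of [d] makes the minimal polynomial
    of [b] over [K] divide [('X - b) ^ n] in [Q['X]], hence equal
    [('X - b) ^ e], so that [e b] lies in [K].  A prime ideal avoiding the powers
    of [d] thus yields a field [L] with two homomorphisms from [Q] that agree on
    [K] and differ at [b], and [L] inherits surjectivity of Frobenius from [Q].
    The product of these fields over all [b] outside [S] presents [S] as an
    equalizer; both claims follow, as monomorphisms of ICM are injective. *)

Set Implicit Arguments. Unset Strict Implicit. Unset Printing Implicit Defensive.
Import GRing.Theory.
Local Open Scope ring_scope.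

(** * Submodules, functionals and quotients *)

Definition subring_set (R : pzRingType) (K : set R) :=
  [/\ K 1, forall x y, K x -> K y -> K (x - y)
    & forall x y, K x -> K y -> K (x * y)].

Definition subfield_set (R : pzRingType) (K : set R) :=
  subring_set K /\ forall x, K x -> x != 0 -> exists2 y, K y & x * y = 1.

Definition submod_set (R : pzRingType) (K W : set R) :=
  [/\ W 0, forall x y, W x -> W y -> W (x + y)
    & forall a x, K a -> W x -> W (a * x)].

Definition reduced (R : pzRingType) := forall x : R, x ^+ 2 = 0 -> x = 0.

Section Submodules.
Variables (R : comPzRingType) (K : set R).
Hypothesis subK : subring_set K.

Lemma subring0 : K 0.
Proof. by case: subK => K1 KB _; rewrite -(subrr 1); apply: KB. Qed.

Lemma subringN x : K x -> K (- x).
Proof. by case: subK => _ KB _ Kx; rewrite -sub0r; apply: KB => //; exact: subring0. Qed.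

Lemma subringD x y : K x -> K y -> K (x + y).
Proof. by case: subK => _ KB _ Kx Ky; rewrite -[y]opprK; apply: KB => //; exact: subringN. Qed.

Lemma subring_nat m : K m%:R.
Proof.
case: subK => K1 _ _; elim: m => [|m IHm]; first exact: subring0.
by rewrite -addn1 natrD; apply: subringD.
Qed.

(** Zorn's lemma; maximality is recorded in the last clause, where [W + K x] has to meet [Y] as soon
    as [x] is outside [W]. A subfield [K] will give hyperplanes, and [K = setT] will give ideals. *)
Lemma maximal_submod_avoiding (W0 Y : set R) :
    submod_set K W0 -> (forall x, W0 x -> ~ Y x) ->
  exists W, [/\ submod_set K W, forall x, W0 x -> W x, forall x, W x -> ~ Y x &
    forall x, ~ W x -> exists a w, [/\ K a, W w & Y (w + a * x)]].
Proof.
case: subK => K1 KB KM [W00 W0D W0M] W0Y.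
(* The guard makes the empty set satisfy [P], as it is the union of the empty chain. *)
pose P (W : set R) := (exists x, W x) ->
  [/\ submod_set K W, forall x, W0 x -> W x & forall x, W x -> ~ Y x].
have [F FP Ftot|W [PW maxW]] := @Zorn_bigcup R P.
  move=> [x0 [X0 FX0 X0x0]].
  have FX X x : F X -> X x ->
    [/\ submod_set K X, forall x, W0 x -> X x & forall x, X x -> ~ Y x].
    by move=> FX Xx; apply: FP => //; exists x.
  split.
  - split.
    + by exists X0 => //; case: (FX _ _ FX0 X0x0) => -[].
    + move=> x y [X FX1 Xx] [X' FX2 Xy].
      have [XX'|X'X] := Ftot _ _ FX1 FX2.
        exists X' => //; case: (FX _ _ FX2 Xy) => -[_ XD _] _ _.
        by apply: XD => //; apply: XX'.
      exists X => //; case: (FX _ _ FX1 Xx) => -[_ XD _] _ _.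
      by apply: XD => //; apply: X'X.
    + move=> a x Ka [X FX1 Xx]; exists X => //.
      by case: (FX _ _ FX1 Xx) => -[_ _ XM] _ _; apply: XM.
  - by move=> x W0x; exists X0 => //; case: (FX _ _ FX0 X0x0) => _ + _; apply.
  - by move=> x [X FX1 Xx]; case: (FX _ _ FX1 Xx) => _ _ XY; exact: XY.
(* An empty maximal set would be properly contained in [W0]. *)
have [W_ex|W_nex] := pselect (exists x, W x); last first.
  exfalso; apply: (maxW W0); last by move=> _; split.
  split; first by move=> x Wx; case: W_nex; exists x.
  by move=> /(_ 0 W00) W0'; apply: W_nex; exists 0.
case: (PW W_ex) => -[WW0 WD WM] W0W WY; exists W; split => // x nWx.
pose V := [set v | exists a w, [/\ K a, W w & v = w + a * x]]%classic.
apply: contrapT => noY; apply: (maxW V).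
  split.
    by move=> w Ww; exists 0, w; split => //; [exact: subring0|rewrite mul0r addr0].
  by move=> VW; apply/nWx/VW; exists 1, 0; split => //; rewrite mul1r add0r.
move=> _; split.
- split.
  + by exists 0, 0; split => //; [exact: subring0|rewrite mul0r addr0].
  + move=> _ _ [a [w [Ka Ww ->]]] [a' [w' [Ka' Ww' ->]]].
    exists (a + a'), (w + w'); split; [exact: subringD|exact: WD|ring].
  + move=> c _ Kc [a [w [Ka Ww ->]]]; exists (c * a), (c * w).
    by split; [exact: KM|exact: WM|ring].
- by move=> w /W0W Ww; exists 0, w; split => //; [exact: subring0|rewrite mul0r addr0].
- by move=> _ [a [w [Ka Ww ->]]] Yv; apply: noY; exists a, w.
Qed.

End Submodules.

Section Functionals.
Variables (R : comNzRingType) (K : set R).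
Hypothesis fieldK : subfield_set K.

Definition functional (phi : R -> R) :=
  [/\ forall x, K (phi x), {morph phi : x y / x + y}
    & forall a x, K a -> phi (a * x) = a * phi x].

(** A submodule [V] containing [W] and maximal without [c] is a complement of the line [K c]; [phi]
    reads off the coefficient of [c]. *)
Lemma separating_functional (W : set R) (c : R) :
    submod_set K W -> ~ W c ->
  exists phi, [/\ functional phi, forall w, W w -> phi w = 0 & phi c = 1].
Proof.
case: fieldK => subK Kinv smW nWc; case: (subK) => K1 KB KM.
have [|V [[V0 VD VM] WV VY maxV]] :=
    @maximal_submod_avoiding R K subK W [set c]%classic smW.
  by move=> x Wx xc; apply: nWc; rewrite -xc.
have nVc : ~ V c by move=> /VY; apply.
have VN x : V x -> V (- x).
  by rewrite -mulN1r; apply: VM; exact: subringN.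
have decomp x : exists a, K a /\ V (x - a * c).
  have [Vx|/maxV [a [w [Ka Vw]]]] := pselect (V x).
    by exists 0; split; [exact: subring0|rewrite mul0r subr0].
  (* Here [w + a * x = c]. Since [c] is not in [V], [a] is nonzero, and its inverse is the
     coefficient of [x]. *)
  move=> /= wc; have [a0|an0] := eqVneq a 0.
    by case: nVc; rewrite -wc a0 mul0r addr0.
  have [a' Ka' aa'] := Kinv _ Ka an0; exists a'; split => //.
  have -> : x - a' * c = - (a' * w).
    rewrite -wc -{1}[x]mul1r -aa'; ring.
  by apply/VN/VM.
have uniq_coef x a a' : K a -> K a' -> V (x - a * c) -> V (x - a' * c) -> a = a'.
  move=> Ka Ka' Va Va'; apply/eqP; rewrite -subr_eq0; apply/negPn/negP => ne0.
  have [a'' Ka'' inv] := Kinv _ (KB _ _ Ka Ka') ne0.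
  apply: nVc; rewrite -[c]mul1r -inv.
  have -> : (a - a') * a'' * c = a'' * ((x - a' * c) + - (x - a * c)) by ring.
  by apply: VM => //; apply: VD => //; apply: VN.
have [phi phiP] := choice decomp.
have phiE x a : K a -> V (x - a * c) -> phi x = a.
  by case: (phiP x) => Kp Vp Ka Va; apply: uniq_coef Vp Va.
exists phi; split.
- split; first by move=> x; case: (phiP x).
  + move=> x y; case: (phiP x) (phiP y) => Kx Vx [Ky Vy].
    apply: phiE; first exact: subringD.
    have -> : x + y - (phi x + phi y) * c = (x - phi x * c) + (y - phi y * c) by ring.
    exact: VD.
  + move=> a x Ka; case: (phiP x) => Kx Vx.
    apply: phiE; first exact: KM.
    have -> : a * x - a * phi x * c = a * (x - phi x * c) by ring.
    exact: VM.
- by move=> w /WV Vw; apply: phiE; [exact: subring0|rewrite mul0r subr0].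
- by apply: phiE => //; rewrite mul1r subrr.
Qed.

End Functionals.

Section Quotients.
Variable R : comNzRingType.

Lemma ideal_quotient (I : set R) :
    submod_set setT I -> ~ I 1 ->
  exists (Q : comNzRingType) (pi : {rmorphism R -> Q}),
    (forall q, exists x, pi x = q) /\ forall x, pi x = 0 <-> I x.
Proof.
move=> [I0 ID IM] I1; pose S : {pred R} := [pred x | `[< I x >]].
have idealS : idealr_closed S.
  split; [exact/asboolP|exact/asboolPn|].
  by move=> a u v /asboolP Iu /asboolP Iv; apply/asboolP/ID => //; exact: IM.
pose mixZ := GRing.isZmodClosed.Build R S (idealr_closedB idealS).
pose mixI := isProperIdeal.Build R S (idealr_closed_nontrivial idealS).
pose J : idealr R := HB.pack S mixZ mixI.
exists {ideal_quot J}, (\pi_{ideal_quot J})%qT; split.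
  by move=> q; exists (repr q); exact: reprK.
move=> x; have -> : 0 = (\pi_{ideal_quot J} 0)%qT by rewrite rmorph0.
split=> [/eqP|Ix]; last apply/eqP.
  by rewrite -Quotient.idealrBE subr0 => /asboolP.
by rewrite -Quotient.idealrBE subr0; apply/asboolP.
Qed.

End Quotients.

(** * Fraction fields and prime ideals *)

Lemma fraction_split (D : idomainType) (z : {fraction D}) :
  exists x y, z = @FracField.tofrac D x / @FracField.tofrac D y.
Proof.
elim/quotW: z => r; exists (val r).1, (val r).2.
have d0 := denom_ratioP r.
apply/eqP; rewrite eq_sym -(inj_eq (mulIf (_ : FracField.tofrac (val r).2 != 0))) ?tofrac_eq0 //.
rewrite divfK ?tofrac_eq0 //; unlock FracField.tofrac.
rewrite -[X in _ == X]FracField.pi_mul; apply/eqP/eqmodP => /=.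
by rewrite /FracField.equivf /FracField.mulf /= !numden_Ratio ?mulr1 ?mul1r ?oner_neq0 ?d0 // mulrC.
Qed.

Lemma field_of_domain (R : comNzRingType) :
    (forall x y : R, x * y = 0 -> x = 0 \/ y = 0) ->
  exists (L : fieldType) (rho : {rmorphism R -> L}),
    injective rho /\ forall z, exists x y, z = rho x / rho y.
Proof.
move=> domR.
(* Inverses are chosen classically; a non-unit is its own value, as [invR_out] requires. *)
pose invR (x : R) := if pselect (exists y, y * x = 1) is left ex then sval (cid ex) else x.
pose unitR : pred R := [pred x | `[< exists y, y * x = 1 >]].
have mulVx : {in unitR, left_inverse 1 invR *%R}.
  move=> x /asboolP ux; rewrite /invR; case: pselect => // ex.
  by case: cid.
have unitPl x y : y * x = 1 -> unitR x by move=> yx; apply/asboolP; exists y.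
have invR_out : {in [predC unitR], invR =1 id}.
  by move=> x /asboolPn nux; rewrite /invR; case: pselect.
pose mixU := GRing.ComNzRing_hasMulInverse.Build R mulVx unitPl invR_out.
pose UR : comUnitRingType := HB.pack (R : Type) R mixU.
have intR : GRing.integral_domain_axiom UR.
  by move=> x y /domR [] ->; rewrite eqxx ?orbT.
pose mixI := GRing.ComUnitRing_isIntegral.Build UR intR.
pose D : idomainType := HB.pack (R : Type) UR mixI.
pose rho : {rmorphism D -> {fraction D}} := @FracField.tofrac D.
exists {fraction D}, rho; split.
  by move=> x y /eqP; rewrite tofrac_eq => /eqP.
exact: fraction_split.
Qed.

(** An ideal [J] maximal without powers of [d] is prime: if [J + R x] and [J + R y] both contain
    powers of [d], then so does [J + R x y]. [L] is the fraction field of [R / J]; the description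
    of its elements as fractions serves later to find [p]-th roots in [L]. *)
Lemma field_avoiding (R : comNzRingType) (d : R) :
    (forall n, d ^+ n != 0) ->
  exists (L : fieldType) (rho : {rmorphism R -> L}),
    rho d != 0 /\ forall z, exists x y, z = rho x / rho y.
Proof.
move=> dN0.
have subT : subring_set (setT : set R) by split.
have [|x /= ->|J [[J0 JD JM] _ JY maxJ]] :=
    @maximal_submod_avoiding R setT subT [set 0]%classic
      [set x | exists n, x = d ^+ n]%classic.
- by split => [//|x y /= -> ->|a x _ /= ->]; rewrite ?addr0 ?mulr0.
- by case=> n /eqP; rewrite eq_sym (negPf (dN0 n)).
have J1 : ~ J 1 by move=> /JY; apply; exists 0%N; rewrite expr0.
have Jprime x y : J (x * y) -> J x \/ J y.
  move=> Jxy; apply: contrapT => /not_orP [/maxJ nx /maxJ ny].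
  case: nx ny => [a [w [_ Jw [n wn]]]] [a' [w' [_ Jw' [n' wn']]]].
  apply: (JY (d ^+ (n + n'))); last by exists (n + n')%N.
  rewrite exprD -wn -wn'.
  have -> : (w + a * x) * (w' + a' * y) =
    (w' + a' * y) * w + (a * x * w' + a * a' * (x * y)) by ring.
  by do 2?[apply: (JD)]; apply: JM.
have [Q [pi [pi_surj piE]]] := @ideal_quotient R J (And3 J0 JD JM) J1.
have [x y|L [rho [rho_inj rho_surj]]] := @field_of_domain Q.
  case: (pi_surj x) (pi_surj y) => x' <- [y' <-]; rewrite -rmorphM => /piE.
  by case/Jprime => /piE ->; [left|right].
exists L, (rho \o pi); split.
  apply/eqP; rewrite -(rmorph0 rho) => /rho_inj /piE /JY; apply.
  by exists 1%N; rewrite expr1.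
move=> z; case: (rho_surj z) => x [y ->].
by case: (pi_surj x) (pi_surj y) => x' <- [y' <-]; exists x', y'.
Qed.

(** * The tensor square over a subfield *)

Section TensorSquare.
Variables (B : comNzRingType) (K : set B).
Hypothesis fieldK : subfield_set K.
Implicit Types (s t : seq (B * B)) (phi : B -> B).

(* Elements of [B (x)_K B] are formal sums of pairs, identified when every
   [K]-linear functional on the second factor maps them to the same element. *)
Definition contract phi s := \sum_(u <- s) u.1 * phi u.2.

Definition same_tensor s t :=
  `[< forall phi, functional K phi -> contract phi s = contract phi t >].

Lemma same_tensor_equiv : equiv_class_of same_tensor.
Proof.
split=> [s|s t|t s u].
- exact/asboolP.
- by apply/asboolP/asboolP => st phi /st ->.
- by move=> /asboolP st /asboolP tu; apply/asboolP => phi phiK; rewrite st ?tu.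
Qed.

Canonical same_tensor_equivRel := EquivRelPack same_tensor_equiv.

(** The proof is kept in the type because the ring structure depends on it: [1 != 0] needs a
    functional that is nonzero at [1]. *)
Definition tensor_square (_ : subfield_set K) := {eq_quot same_tensor}%qT.
Local Notation tensor := (tensor_square fieldK).
HB.instance Definition _ : EqQuotient _ same_tensor tensor := EqQuotient.on tensor.
HB.instance Definition _ := Choice.on tensor.
Implicit Types x y z : tensor.

Definition tensor_of s : tensor := (\pi_tensor s)%qT.
Definition contractq phi x := contract phi (repr x).

Lemma contractq_pi phi s : functional K phi -> contractq phi (tensor_of s) = contract phi s.
Proof.
move=> phiK; have /eqmodP/asboolP := reprK (tensor_of s).
by apply.
Qed.

Lemma tensor_ext x y :
  (forall phi, functional K phi -> contractq phi x = contractq phi y) -> x = y.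
Proof.
by move=> xy; rewrite -[x]reprK -[y]reprK; apply/eqmodP/asboolP.
Qed.

(** This makes multiplication respect the identification: contracting a product by [phi] amounts to
    contracting its second factor by functionals of this form. *)
Lemma functional_mull phi a : functional K phi -> functional K (fun v => phi (a * v)).
Proof.
move=> [phiK phiD phiZ]; split=> [v|v w|c v Kc].
- exact: phiK.
- by rewrite /= mulrDr phiD.
- by rewrite /= mulrCA (phiZ c).
Qed.

Lemma contract_cat phi s t : contract phi (s ++ t) = contract phi s + contract phi t.
Proof. exact: big_cat. Qed.

Definition mul_terms s t := [seq (u.1 * v.1, u.2 * v.2) | u <- s, v <- t].

Lemma contract_mul phi s t :
  contract phi (mul_terms s t) = \sum_(u <- s) u.1 * contract (fun v => phi (u.2 * v)) t.
Proof.
rewrite /contract big_allpairs_dep /=; apply: eq_bigr => u _.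
by rewrite mulr_sumr; apply: eq_bigr => v _; rewrite mulrA.
Qed.

Lemma contract_mulC phi s t : contract phi (mul_terms s t) = contract phi (mul_terms t s).
Proof.
rewrite /contract !big_allpairs_dep exchange_big /=; apply: eq_bigr => u _.
by apply: eq_bigr => v _; rewrite mulrC [v.1 * _]mulrC [v.2 * _]mulrC mulrC.
Qed.

Definition tensor_zero := tensor_of [::].
Definition tensor_one := tensor_of [:: (1, 1)].
Definition tensor_add x y := tensor_of (repr x ++ repr y).
Definition tensor_opp x := tensor_of [seq (- u.1, u.2) | u <- repr x].
Definition tensor_mul x y := tensor_of (mul_terms (repr x) (repr y)).

Lemma contractq0 phi : functional K phi -> contractq phi tensor_zero = 0.
Proof. by move=> phiK; rewrite contractq_pi // /contract big_nil. Qed.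

Lemma contractqD phi x y : functional K phi ->
  contractq phi (tensor_add x y) = contractq phi x + contractq phi y.
Proof. by move=> phiK; rewrite contractq_pi // contract_cat. Qed.

Lemma contractqN phi x : functional K phi ->
  contractq phi (tensor_opp x) = - contractq phi x.
Proof.
move=> phiK; rewrite contractq_pi // /contractq /contract big_map -sumrN.
by apply: eq_bigr => u _; rewrite mulNr.
Qed.

Lemma contractqM phi x y : functional K phi ->
  contractq phi (tensor_mul x y) =
    \sum_(u <- repr x) u.1 * contractq (fun v => phi (u.2 * v)) y.
Proof. by move=> phiK; rewrite contractq_pi // contract_mul. Qed.

Lemma tensor_addA : associative tensor_add.
Proof. by move=> x y z; apply: tensor_ext => phi phiK; rewrite !contractqD // addrA. Qed.

Lemma tensor_addC : commutative tensor_add.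
Proof. by move=> x y; apply: tensor_ext => phi phiK; rewrite !contractqD // addrC. Qed.

Lemma tensor_add0 : left_id tensor_zero tensor_add.
Proof.
by move=> x; apply: tensor_ext => phi phiK; rewrite contractqD // contractq0 // add0r.
Qed.

Lemma tensor_addN : left_inverse tensor_zero tensor_opp tensor_add.
Proof.
move=> x; apply: tensor_ext => phi phiK.
by rewrite contractqD // contractqN // contractq0 // addNr.
Qed.

HB.instance Definition _ :=
  GRing.isZmodule.Build tensor tensor_addA tensor_addC tensor_add0 tensor_addN.

Lemma tensor_mulC : commutative tensor_mul.
Proof.
by move=> x y; apply: tensor_ext => phi phiK; rewrite !contractq_pi // contract_mulC.
Qed.

(** Proved before associativity because the contraction of [x (y z)] expands to a double sum over
    [x] and [y] that is visibly symmetric. *)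
Lemma tensor_mulCA : left_commutative tensor_mul.
Proof.
move=> x y z; apply: tensor_ext => phi phiK; rewrite !contractqM //.
have expand x' y' : \sum_(u <- repr x') u.1 * contractq (fun v => phi (u.2 * v)) (tensor_mul y' z) =
  \sum_(u <- repr x') \sum_(w <- repr y')
    u.1 * w.1 * contractq (fun v => phi (u.2 * (w.2 * v))) z.
  apply: eq_bigr => u _; rewrite contractqM; last exact: functional_mull.
  by rewrite mulr_sumr; apply: eq_bigr => w _; rewrite mulrA.
rewrite !expand exchange_big /=; apply: eq_bigr => u _; apply: eq_bigr => w _.
rewrite [w.1 * _]mulrC; congr (_ * contractq _ _).
by apply/funext => v; rewrite mulrCA.
Qed.

Lemma tensor_mulA : associative tensor_mul.
Proof.
by move=> x y z; rewrite [RHS]tensor_mulC [RHS]tensor_mulCA [tensor_mul z y]tensor_mulC.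
Qed.

Lemma tensor_mul1 : left_id tensor_one tensor_mul.
Proof.
move=> x; rewrite tensor_mulC; apply: tensor_ext => phi phiK.
rewrite contractqM // /contractq [RHS]/contract; apply: eq_bigr => u _.
rewrite [X in u.1 * X]contractq_pi; last exact: functional_mull.
by rewrite /contract big_seq1 /= mul1r mulr1.
Qed.

Lemma tensor_mulDl : left_distributive tensor_mul tensor_add.
Proof.
move=> x y z; rewrite ![tensor_mul _ z]tensor_mulC; apply: tensor_ext => phi phiK.
rewrite contractqD // !contractqM // -big_split; apply: eq_bigr => u _ /=.
by rewrite contractqD ?mulrDr //; exact: functional_mull.
Qed.

Lemma tensor_1neq0 : tensor_one != tensor_zero.
Proof.
case: (fieldK) => -[K1 _ _] _.
have [| |phi [phiK _ phi1]] := @separating_functional B K fieldK [set 0]%classic 1.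
- by split => [//|x y /= -> ->|a x _ /= ->]; rewrite ?addr0 ?mulr0.
- by move=> /eqP; rewrite oner_eq0.
apply/eqP => /(congr1 (contractq phi)); rewrite contractq0 // contractq_pi //.
by rewrite /contract big_seq1 /= mul1r phi1 => /eqP; rewrite oner_eq0.
Qed.

HB.instance Definition _ := GRing.Zmodule_isComNzRing.Build tensor
  tensor_mulA tensor_mulC tensor_mul1 tensor_mulDl tensor_1neq0.

Definition tensor_left (a : B) : tensor := tensor_of [:: (a, 1)].
Definition tensor_right (a : B) : tensor := tensor_of [:: (1, a)].

Lemma contractq1 phi a b : functional K phi ->
  contractq phi (tensor_of [:: (a, b)]) = a * phi b.
Proof. by move=> phiK; rewrite contractq_pi // /contract big_seq1. Qed.

(** The chosen representatives are exchanged for [s] and [t] one at a time, commutativity bringing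
    each in turn into second position. *)
Lemma tensor_ofM s t : tensor_of (mul_terms s t) = tensor_of s * tensor_of t.
Proof.
apply: tensor_ext => phi phiK; rewrite [_ * _]tensor_mulC contractqM //.
rewrite -[LHS]/(contractq phi (tensor_of _)) contractq_pi // contract_mulC.
have -> : \sum_(u <- repr (tensor_of t)) u.1 * contractq (fun v => phi (u.2 * v)) (tensor_of s) =
  contract phi (mul_terms (repr (tensor_of t)) s).
  rewrite contract_mul; apply: eq_bigr => u _; rewrite contractq_pi //.
  exact: functional_mull.
rewrite ![contract phi (mul_terms _ s)]contract_mulC !contract_mul.
apply: eq_bigr => u _; rewrite -contractq_pi //; exact: functional_mull.
Qed.

Lemma functionalB phi : functional K phi -> {morph phi : v w / v - w}.
Proof.
move=> phiK v w; apply/eqP; rewrite eq_sym subr_eq; case: (phiK) => _ phiD _.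
by rewrite -phiD subrK.
Qed.

Lemma tensor_left_zmod : zmod_morphism tensor_left.
Proof.
move=> a b; apply: tensor_ext => phi phiK.
by rewrite contractqD // contractqN // !contractq1 // mulrBl.
Qed.

Lemma tensor_right_zmod : zmod_morphism tensor_right.
Proof.
move=> a b; apply: tensor_ext => phi phiK.
by rewrite contractqD // contractqN // !contractq1 // !mul1r functionalB.
Qed.

Lemma tensor_left_monoid : monoid_morphism tensor_left.
Proof. by split=> // a b; rewrite -tensor_ofM /mul_terms /= mul1r. Qed.

Lemma tensor_right_monoid : monoid_morphism tensor_right.
Proof. by split=> // a b; rewrite -tensor_ofM /mul_terms /= mul1r. Qed.

HB.instance Definition _ := GRing.isZmodMorphism.Build B tensor tensor_left tensor_left_zmod.
HB.instance Definition _ := GRing.isMonoidMorphism.Build B tensor tensor_left tensor_left_monoid.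
HB.instance Definition _ := GRing.isZmodMorphism.Build B tensor tensor_right tensor_right_zmod.
HB.instance Definition _ := GRing.isMonoidMorphism.Build B tensor tensor_right tensor_right_monoid.

Lemma tensor_balanced a : K a -> tensor_left a = tensor_right a.
Proof.
move=> Ka; apply: tensor_ext => phi phiK; rewrite !contractq1 //.
by case: phiK => _ _ phiZ; rewrite mul1r -[in RHS](mulr1 a) phiZ.
Qed.

Lemma contractq_sum phi s : functional K phi ->
  contractq phi (\sum_(u <- s) tensor_left u.1 * tensor_right u.2) = contract phi s.
Proof.
move=> phiK; elim: s => [|u s IHs].
  by rewrite big_nil contractq0 // /contract big_nil.
rewrite big_cons contractqD // IHs -tensor_ofM contractq_pi //.
by rewrite /contract /= !big_cons big_nil /= addr0 mulr1 mul1r.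
Qed.

Lemma tensor_sum x : exists s, x = \sum_(u <- s) tensor_left u.1 * tensor_right u.2.
Proof.
by exists (repr x); apply: tensor_ext => phi phiK; rewrite contractq_sum.
Qed.

End TensorSquare.

(** * Nilpotence in the tensor square *)

Lemma reducedX (R : nzRingType) (x : R) n : reduced R -> x ^+ n = 0 -> x = 0.
Proof.
move=> redR xn0; have {xn0} : x ^+ (2 ^ n) = 0.
  by rewrite -(subnK (ltnW (ltn_expl n (isT : 1 < 2)%N))) exprD xn0 mulr0.
elim: n => [|n IHn]; first by rewrite expr1.
by rewrite expnSr exprM => /redR.
Qed.

(** Suppose the coefficients of [f] below [j], where [j < deg f], vanish. Multiply the coefficient
    of ['X^(j + i)] in [f * g] by [f]_j[: by induction on]i[only the square of]f[_j] times
    [g]_i[survives, so]f[_j * g]_i[squares to zero and vanishes. At]i = deg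
    g[this gives]f[_j = 0]. *)
Lemma reduced_factor_Xn (R : comNzRingType) (f g : {poly R}) n :
  reduced R -> f \is monic -> g \is monic -> f * g = 'X^n ->
  f = 'X^((size f).-1).
Proof.
move=> redR monf mong fg.
have sf : size f = (size f).-1.+1 by rewrite prednK // size_poly_gt0 monic_neq0.
have sg : size g = (size g).-1.+1 by rewrite prednK // size_poly_gt0 monic_neq0.
have def_n : n = ((size f).-1 + (size g).-1)%N.
  apply: succn_inj; rewrite -(size_polyXn R n) -fg size_monicM ?monic_neq0 //.
  by rewrite sf sg addnS.
suff low j : (j < (size f).-1)%N -> f`_j = 0.
  apply/polyP => j; rewrite coefXn; have [->|nj] := eqVneq; first exact/monicP.
  have [/low -> //|ltj] := ltnP j (size f).-1.
  by rewrite nth_default // sf ltn_neqAle eq_sym nj.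
elim/ltn_ind: j => j IHj ltj.
suff kill i : (i <= (size g).-1)%N -> f`_j * g`_i = 0.
  by move: (kill _ (leqnn _)); rewrite -lead_coefE (monicP mong) mulr1.
elim/ltn_ind: i => i IHi lei; apply: redR.
have := congr1 (fun p : {poly R} => f`_j * p`_(j + i)) fg.
rewrite /= coefXn eqn_leq [(n <= _)%N]leqNgt def_n.
have -> : (j + i < (size f).-1 + (size g).-1)%N by rewrite -addSn leq_add.
rewrite andbF mulr0 coefM (bigD1 (Ordinal (leq_addr i j : j < (j + i).+1)%N)) //=.
rewrite addKn mulrDr mulr_sumr big1 ?addr0 => [|[k ltk]].
  by have -> : (f`_j * g`_i) ^+ 2 = f`_j * (f`_j * g`_i) * g`_i by [ring] => ->; rewrite mul0r.
rewrite -val_eqE /= neq_ltn => /orP[ltkj|ltjk].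
  by rewrite (IHj k) ?mul0r ?mulr0 // (ltn_trans ltkj).
rewrite mulrCA IHi ?mulr0 //; first by rewrite ltn_subLR // ltn_add2r.
by rewrite (leq_trans _ lei) // leq_subLR leq_add2r ltnW.
Qed.

(** [R] may have zero divisors, so the leading term is split off: it becomes a monic power of
    ['X + c], and the rest keeps a smaller size. *)
Lemma monic_shift (R : comNzRingType) (p : {poly R}) (c : R) :
  p \is monic ->
  p \Po ('X + c%:P) \is monic /\ size (p \Po ('X + c%:P)) = size p.
Proof.
move=> monp; have p0 := monic_neq0 monp.
have sp : size p = (size p).-1.+1 by rewrite prednK // size_poly_gt0.
set e := (size p).-1 in sp.
have XcE : 'X + c%:P = 'X - (- c)%:P by rewrite polyCN opprK.
have monXc : ('X + c%:P) ^+ e \is monic by rewrite XcE monic_exp ?monicXsubC.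
have sizeXc : size (('X + c%:P) ^+ e) = e.+1 by rewrite XcE size_exp_XsubC.
have pE : p = 'X^e + \sum_(i < e) p`_i *: 'X^i.
  rewrite -{1}(coefK p) poly_def sp big_ord_recr /= addrC.
  by have -> : p`_e = 1 by [exact/monicP]; rewrite scale1r.
set r := \sum_(i < e) _ in pE.
have size_r : (size (r \Po ('X + c%:P)) < e.+1)%N.
  rewrite ltnS raddf_sum; apply: (leq_trans (size_sum _ _ _)).
  apply/bigmax_leqP => i _; rewrite /= comp_polyZ comp_Xn_poly.
  by rewrite (leq_trans (size_scale_leq _ _)) // XcE size_exp_XsubC.
have -> : p \Po ('X + c%:P) = ('X + c%:P) ^+ e + (r \Po ('X + c%:P)).
  by rewrite {1}pE rmorphD /= comp_Xn_poly.
rewrite size_polyDl sizeXc // sp; split => //.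
by rewrite monicE lead_coefDl ?sizeXc.
Qed.

Lemma coef_XsubCX (R : comNzRingType) (c : R) e :
  (('X - c%:P) ^+ e.+1)`_e = - c *+ e.+1.
Proof.
elim: e => [|e IHe]; first by rewrite expr1 coefB coefX coefC sub0r mulr1n.
rewrite exprSr mulrBr coefB coefMX /= IHe coefMC.
have : lead_coef (('X - c%:P) ^+ e.+1) = 1 by apply/monicP/monic_exp/monicXsubC.
by rewrite lead_coefE size_exp_XsubC /= => ->; rewrite mul1r [RHS]mulrSr.
Qed.

Section Nilpotence.
Variables (B : comNzRingType) (K : set B).
Hypothesis fieldK : subfield_set K.
Hypothesis redB : reduced B.
Hypothesis rootK : forall p, p \in [pchar B] -> forall a, K a -> exists2 c, K c & c ^+ p = a.

(** Integers lie in [K], so those nonzero in [B] are invertible; prime factors are cancelled from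
    [n] until one of them is zero in [B]. *)
Lemma subfield_char n : (0 < n)%N -> n%:R = 0 :> B -> exists p, p \in [pchar B].
Proof.
case: fieldK => subK Kinv; elim/ltn_ind: n => n IHn n_gt0 n0.
have [n1|n1] := leqP n 1.
  by case/eqP: (oner_neq0 B); rewrite -n0; case: n n1 n_gt0 {IHn n0} => [|[]].
have [p0|p_neq0] := eqVneq ((pdiv n)%:R : B) 0.
  by exists (pdiv n); rewrite inE pdiv_prime // p0 eqxx.
have [u _ pu] := Kinv _ (subring_nat subK _) p_neq0.
apply: (IHn (n %/ pdiv n)%N).
- by rewrite ltn_Pdiv // prime_gt1 // pdiv_prime.
- by rewrite divn_gt0 ?pdiv_gt0 // dvdn_leq // pdiv_dvd.
transitivity ((n %/ pdiv n)%:R * ((pdiv n)%:R * u)); first by rewrite pu mulr1.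
by rewrite mulrA -natrM divnK ?pdiv_dvd // n0 mul0r.
Qed.

(** Frobenius is injective on a reduced ring, so [a] is the root found in [K]. *)
Lemma subfield_root p a : p \in [pchar B] -> K (a ^+ p) -> K a.
Proof.
move=> charp /(rootK charp) [c Kc ca].
suff -> : a = c by [].
apply/eqP; rewrite -subr_eq0; apply/eqP/(reducedX redB (n := p)).
by rewrite -[LHS](pFrobenius_autE charp) rmorphB /= !pFrobenius_autE ca subrr.
Qed.

Local Notation T := (tensor_square fieldK).
Local Notation g := (tensor_left fieldK).
Local Notation h := (tensor_right fieldK).
Variable b : B.

(** The [K]-span of the first [k] powers of [b], starting with [1]. *)
Let powers k : set B := [set x | exists p : {poly B},
  [/\ forall i, K p`_i, (size p <= k)%N & x = p.[b]]]%classic.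

(** The tensor [\sum_i p_i (x) b ^ i], with arbitrary coefficients from [B] on the left. *)
Let eval (p : {poly B}) : T := (map_poly g p).[h b].

Lemma powers_submod k : submod_set K (powers k).
Proof.
case: fieldK => subK _; case: (subK) => K1 KB KM; split.
- by exists 0; split; rewrite ?size_poly0 ?horner0 // => i; rewrite coef0; exact: subring0.
- move=> _ _ [p [Kp sp ->]] [q [Kq sq ->]]; exists (p + q); split.
  + by move=> i; rewrite coefD; apply: subringD.
  + by rewrite (leq_trans (size_polyD _ _)) // geq_max sp.
  + by rewrite hornerD.
- move=> a _ Ka [p [Kp sp ->]]; exists (a *: p); split.
  + by move=> i; rewrite coefZ; apply: KM.
  + by rewrite (leq_trans (size_scale_leq _ _)).
  + by rewrite hornerZ.
Qed.

Lemma tensor_sum_eq0 (s : seq (B * B)) phi : functional K phi ->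
  \sum_(u <- s) g u.1 * h u.2 = 0 -> \sum_(u <- s) u.1 * phi u.2 = 0.
Proof.
move=> phiK /(congr1 (contractq phi)); rewrite contractq_sum // => contr0.
by rewrite -[LHS]/(contract phi s) contr0; exact: contractq0.
Qed.

(** Otherwise a functional that kills the lower powers of [b] and is [1] at the top one would
    contract [eval p] to the leading coefficient of [p]. *)
Lemma eval_eq0_dep (p : {poly B}) :
  p != 0 -> eval p = 0 -> powers (size p).-1 (b ^+ (size p).-1).
Proof.
move=> p0 evp; apply: contrapT => nW.
have [phi [phiK phi0 phi1]] := separating_functional fieldK (powers_submod _) nW.
pose s := [seq (p`_i, b ^+ i) | i : 'I_(size p)].
have : \sum_(u <- s) u.1 * phi u.2 = 0.
  apply: tensor_sum_eq0 => //; rewrite big_map big_enum /= -[RHS]evp /eval.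
  rewrite (@horner_coef_wide _ (size p)) ?size_poly //.
  by apply: eq_bigr => i _; rewrite coef_map rmorphXn.
rewrite big_map big_enum /=.
have sp : size p = (size p).-1.+1 by rewrite prednK // size_poly_gt0.
rewrite sp big_ord_recr /= big1 ?add0r => [|i _].
  by rewrite phi1 mulr1 -lead_coefE => /eqP; rewrite lead_coef_eq0 (negPf p0).
rewrite phi0 ?mulr0 //; exists 'X^i; split.
- case: fieldK => subK _; case: (subK) => K1 _ _ j; rewrite coefXn.
  by case: (_ == _) => //; exact: subring0.
- by rewrite size_polyXn.
- by rewrite hornerXn.
Qed.

Lemma tensor_diff_nilpotent n : (h b - g b) ^+ n = 0 -> K b.
Proof.
move=> nil; case: (fieldK) => subK Kinv; case: (subK) => K1 KB KM.
have [[p charp]|nochar] := pselect (exists p, p \in [pchar B]).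
  have charT : p \in [pchar T] by exact: (rmorph_pchar g charp).
  have p_pr := pcharf_prime charp.
  (* Since [n <= p ^ n], the exponent can be raised to a power of [p], where Frobenius splits the
     difference. *)
  have {nil} : (h b - g b) ^+ (p ^ n) = 0.
    by rewrite -(subnK (ltnW (ltn_expl n (prime_gt1 p_pr)))) exprD nil mulr0.
  have -> : (h b - g b) ^+ (p ^ n) = h (b ^+ (p ^ n)) - g (b ^+ (p ^ n)).
    elim: n => [|n IHn]; first by rewrite !expr1.
    rewrite expnSr !exprM IHn -[LHS](pFrobenius_autE charT) rmorphB /=.
    by rewrite !pFrobenius_autE !rmorphXn.
  move=> diff0; have : K (b ^+ (p ^ n)).
    apply: contrapT => nK.
    (* With [c = b ^ (p ^ n)], a functional that is zero on [K] and [1] at [c] contracts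
       [1 (x) c - c (x) 1] to [1]. *)
    have [phi [phiK phi0 phi1]] := separating_functional fieldK
      (And3 (subring0 subK) (subringD subK) KM) nK.
    have := @tensor_sum_eq0 [:: (1, b ^+ (p ^ n)); (- b ^+ (p ^ n), 1)] phi phiK.
    rewrite !big_cons !big_nil /= !addr0 !rmorphN !rmorph1 mul1r mulr1 diff0.
    rewrite mul1r phi1 (phi0 1) // mulr0 addr0 => /(_ erefl) /eqP.
    by rewrite oner_eq0.
  elim: n {diff0} => [|n IHn]; first by rewrite expr1.
  by rewrite expnSr exprM => /(subfield_root charp).
have eval0 : eval (('X - b%:P) ^+ n) = 0.
  by rewrite /eval rmorphXn /= map_polyXsubC horner_exp hornerXsubC.
have monXb : ('X - b%:P) ^+ n \is monic by rewrite monic_exp ?monicXsubC.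
have := eval_eq0_dep (monic_neq0 monXb) eval0; rewrite size_exp_XsubC /= => dep.
(* The least such [e] is the degree of the minimal polynomial [m] of [b] over [K]. *)
have ex_e : exists e, `[< powers e (b ^+ e) >] by exists n; apply/asboolP.
case: (ex_minnP ex_e) => e /asboolP [p [Kp sp be]] mine.
pose m := 'X^e - p.
have sm : size m = e.+1 by rewrite size_polyDl size_polyXn // size_polyN ltnS.
have monm : m \is monic.
  by rewrite monicE lead_coefDl ?lead_coefXn // size_polyN size_polyXn ltnS.
have Km i : K m`_i.
  rewrite coefB coefXn; apply: KB => //.
  by case: (_ == _) => //; exact: subring0.
(* The coefficients of [m] lie in [K], so they can be moved to the right factor, where [m] vanishes
   at [b]. *)
have evalm : eval m = 0.
  rewrite /eval.
  have -> : map_poly g m = map_poly h m.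
    by apply/polyP => i; rewrite !coef_map /= tensor_balanced.
  by rewrite horner_map /= hornerD hornerN hornerXn be subrr rmorph0.
have divE := Pdiv.RingMonic.rdivp_eq monm (('X - b%:P) ^+ n).
set q := Pdiv.CommonRing.rdivp _ _ in divE.
set r := Pdiv.CommonRing.rmodp _ _ in divE.
(* The remainder has coefficients in [B] only, but [eval_eq0_dep] still turns it into a dependence
   over [K], of degree below [e]. *)
have r0 : r = 0.
  apply/eqP/negPn/negP => r_neq0.
  have evalr : eval r = 0.
    have -> : r = ('X - b%:P) ^+ n - q * m by rewrite divE addrAC subrr add0r.
    by rewrite /eval rmorphB hornerD hornerN rmorphM hornerM
      -/(eval _) -/(eval m) evalm mulr0 subr0.
  have /asboolP/mine := eval_eq0_dep r_neq0 evalr.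
  apply/negP; rewrite -ltnNge.
  have := Pdiv.CommonRing.ltn_rmodpN0 (('X - b%:P) ^+ n) (monic_neq0 monm).
  have sr : (0 < size r)%N by rewrite size_poly_gt0.
  by rewrite -/r sm -{1}(prednK sr).
rewrite r0 addr0 mulrC in divE.
have monq : q \is monic by rewrite -(monicMl _ monm) -divE.
(* Substituting ['X + b] turns the factorization of [('X - b) ^ n] into one of ['X^n]. *)
have [monm' sm'] := monic_shift b monm.
have [monq' _] := monic_shift b monq.
have mX : (m \Po ('X + b%:P)) * (q \Po ('X + b%:P)) = 'X^n.
  by rewrite -rmorphM /= -divE rmorphXn /= rmorphB /= comp_polyX comp_polyC addrK.
have := reduced_factor_Xn redB monm' monq' mX.
rewrite sm' sm /= => /(congr1 (comp_poly ('X - b%:P))).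
rewrite comp_polyXaddC_K comp_Xn_poly => mE.
(* For [e = 0] the span is zero and would contain [b ^ 0 = 1]. *)
have e_gt0 : (0 < e)%N.
  rewrite lt0n; apply/eqP => e0; move: be sp; rewrite e0 leqn0 size_poly_eq0.
  by move=> + /eqP p0; rewrite p0 expr0 horner0 => /eqP; rewrite oner_eq0.
have e_neq0 : e%:R != 0 :> B by apply/eqP => /(subfield_char e_gt0).
have [u Ku eu] := Kinv _ (subring_nat subK _) e_neq0.
(* The subleading coefficient of [m = ('X - b) ^ e] is [- e b]; it lies in [K], where [e] is
   invertible. *)
have := coef_XsubCX b e.-1; rewrite prednK // -mE => m_coef.
have := Km e.-1; rewrite m_coef => /(subringN subK); rewrite mulNrn opprK => Keb.
have -> : b = b *+ e * u by rewrite -mulr_natr -mulrA eu mulr1.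
exact: KM.
Qed.

End Nilpotence.

(** * Implicitly closed meadows *)

Lemma subfield_separation (B : comNzRingType) (K : set B) (b : B) :
    subfield_set K -> reduced B ->
    (forall p, p \in [pchar B] -> forall x, exists y : B, y ^+ p = x) ->
    (forall p, p \in [pchar B] -> forall a, K a -> exists2 c, K c & c ^+ p = a) ->
    ~ K b ->
  exists (L : fieldType) (g h : {rmorphism B -> L}),
    [/\ weakly_rooted L, forall a, K a -> g a = h a & g b != h b].
Proof.
move=> fieldK redB frobB rootK nKb.
pose l := tensor_left fieldK; pose r := tensor_right fieldK.
have [n|L [rho [rho_d rho_frac]]] := @field_avoiding (tensor_square fieldK) (r b - l b).
  by apply/eqP => /(tensor_diff_nilpotent redB rootK).
exists L, (rho \o l), (rho \o r); split.
- have [[p charL]|nochar] := pselect (exists p, p \in [pchar L]); last first.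
    by left=> p; apply/negP => charL; apply: nochar; exists p.
  right; exists p; split => //.
  (* Otherwise [p] would be invertible in [K], hence nonzero in [L]. *)
  have charB : p \in [pchar B].
    rewrite inE (pcharf_prime charL) /=; apply/negPn/negP => p0.
    case: (fieldK) => subK Kinv; have [u _ pu] := Kinv _ (subring_nat subK p) p0.
    have := oner_neq0 L; rewrite -(rmorph1 (rho \o l)) -pu rmorphM rmorph_nat.
    by rewrite (pcharf0 charL) mul0r eqxx.
  (* Pure tensors get roots factor by factor, and sums by additivity of Frobenius; fractions then
     give all of [L]. *)
  have rootT (x : tensor_square fieldK) : exists y : L, y ^+ p = rho x.
    have [s ->] := tensor_sum x; elim: s => [|[u v] s [y IHs]].
      exists 0; rewrite big_nil rmorph0 expr0n.
      by case: p charL {charB} => // /pcharf_prime.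
    have [[u' <-] [v' <-]] := (frobB _ charB u, frobB _ charB v).
    exists (rho (l u') * rho (r v') + y).
    rewrite -(pFrobenius_autE charL) rmorphD rmorphM /= !(pFrobenius_autE charL) IHs.
    by rewrite big_cons /= !rmorphD !rmorphM !rmorphXn.
  move=> z; have [x [y ->]] := rho_frac z.
  have [[x' <-] [y' <-]] := (rootT x, rootT y).
  by exists (x' / y'); rewrite expr_div_n.
- by move=> a Ka /=; rewrite /l tensor_balanced.
- by rewrite /= eq_sym -subr_eq0 -rmorphB.
Qed.

(** Total on every field: [xget] returns [0] if the root is missing, which cannot happen in a weakly
    rooted field of characteristic [p]. *)
Definition field_root (L : fieldType) p (x : L) : L :=
  if p \in [pchar L] then xget 0 [set y | y ^+ p = x]%classic else 0.

Definition field_alg (L : fieldType) : alg :=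
  @Alg L +%R *%R -%R 0 1 GRing.inv (@field_root L).

Definition prod_alg (I : Type) (F : I -> fieldType) : alg :=
  @Alg (forall i, F i) (fun x y i => x i + y i) (fun x y i => x i * y i)
    (fun x i => - x i) (fun=> 0) (fun=> 1) (fun x i => (x i)^-1)
    (fun p x i => field_root p (x i)).

Lemma pth_root_inj (L : fieldType) p (x y : L) :
  p \in [pchar L] -> x ^+ p = y ^+ p -> x = y.
Proof.
by move=> charL; rewrite -!(pFrobenius_autE charL); apply: fmorph_inj.
Qed.

Lemma field_root_unique (L : fieldType) p (x y : L) :
  p \in [pchar L] -> y ^+ p = x -> field_root p x = y.
Proof.
move=> charL yx; rewrite /field_root charL; apply: (pth_root_inj charL).
by rewrite yx; apply: (@xgetPex _ 0 [set y | y ^+ p = x]%classic); exists y.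
Qed.

Lemma field_rootK (L : fieldType) p (x : L) :
  weakly_rooted L -> p \in [pchar L] -> field_root p x ^+ p = x.
Proof.
move=> [char0|[q [charq rootq]]] charp; first by rewrite char0 in charp.
have := charp; rewrite (pcharf_eq charq) => /eqP pq; subst q.
by have [y yx] := rootq x; rewrite (field_root_unique charp yx).
Qed.

Lemma ICM_embedding (B : alg) : ICM B <->
  exists (I : Type) (F : I -> fieldType) (f : B -> prod_alg F),
    [/\ forall i, weakly_rooted (F i), is_hom f & injective f].
Proof.
split=> [[I [F [f [wr [injf [fD [fM [fN [f0 [f1 [fV fR]]]]]]]]]]]|].
  exists I, F, f; split => //; do 6?split.
  - by move=> x y; apply: functional_extensionality_dep => i; rewrite fD.
  - by move=> x y; apply: functional_extensionality_dep => i; rewrite fM.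
  - by move=> x; apply: functional_extensionality_dep => i; rewrite fN.
  - by apply: functional_extensionality_dep => i; rewrite f0.
  - by apply: functional_extensionality_dep => i; rewrite f1.
  - by move=> x; apply: functional_extensionality_dep => i; rewrite fV.
  - move=> p p_pr x; apply: functional_extensionality_dep => i /=.
    have [rootP root0] := fR p p_pr x i.
    have [charp|ncharp] := boolP (p \in [pchar (F i)]).
      by rewrite (field_root_unique charp (rootP charp)).
    by rewrite /field_root (negPf ncharp) root0.
move=> [I [F [f [wr [fD [fM [fN [f0 [f1 [fV fR]]]]]] injf]]]].
exists I, F, f; do 8?split => //.
- by move=> x y i; rewrite fD.
- by move=> x y i; rewrite fM.
- by move=> x i; rewrite fN.
- by move=> i; rewrite f0.
- by move=> i; rewrite f1.
- by move=> x i; rewrite fV.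
- move=> p p_pr x i; rewrite fR //=; split => [|/negPf ncharp].
    by move=> charp; rewrite field_rootK.
  by rewrite /field_root ncharp.
Qed.

Lemma is_hom_prod (B : alg) (I : Type) (F : I -> fieldType) (f : B -> prod_alg F) :
  (forall i, is_hom (f^~ i : B -> field_alg (F i))) <-> is_hom f.
Proof.
split=> [hom_f|[fD [fM [fN [f0 [f1 [fV fR]]]]]] i].
  by do 6?split => *; apply: functional_extensionality_dep => i;
    have [fD [fM [fN [f0 [f1 [fV fR]]]]]] := hom_f i;
    rewrite ?fD ?fM ?fN ?f0 ?f1 ?fV ?fR.
by do 6?split => *; rewrite ?fD ?fM ?fN ?f0 ?f1 ?fV ?fR.
Qed.

Lemma is_hom_comp (A B C : alg) (f : A -> B) (g : B -> C) :
  is_hom f -> is_hom g -> is_hom (g \o f).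
Proof.
move=> [fD [fM [fN [f0 [f1 [fV fR]]]]]] [gD [gM [gN [g0 [g1 [gV gR]]]]]].
by do 6?split => *; rewrite /= ?fD ?fM ?fN ?f0 ?f1 ?fV ?fR // ?gD ?gM ?gN ?g0 ?g1 ?gV ?gR.
Qed.

Lemma ICM_sub (A B : alg) (f : A -> B) :
  ICM B -> is_hom f -> injective f -> ICM A.
Proof.
move=> /ICM_embedding [I [F [e [wr hom_e inj_e]]]] hom_f inj_f; apply/ICM_embedding.
by exists I, F, (e \o f); split => //; [exact: is_hom_comp|exact: inj_comp].
Qed.

Lemma ICM_prod (I : Type) (F : I -> fieldType) :
  (forall i, weakly_rooted (F i)) -> ICM (prod_alg F).
Proof. by move=> wr; apply/ICM_embedding; exists I, F, id; split. Qed.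

(** * Subalgebras, squares and monomorphisms *)

Section Subalgebras.
Variables (B : alg) (S : B -> Prop).
Hypothesis subS : is_subuniverse S.

Definition sub_add (x y : {x | S x}) : {x | S x} :=
  exist _ _ (proj1 subS _ _ (svalP x) (svalP y)).
Definition sub_mul (x y : {x | S x}) : {x | S x} :=
  exist _ _ (proj1 (proj2 subS) _ _ (svalP x) (svalP y)).
Definition sub_opp (x : {x | S x}) : {x | S x} :=
  exist _ _ (proj1 (proj2 (proj2 subS)) _ (svalP x)).
Definition sub_zero : {x | S x} := exist _ _ (proj1 (proj2 (proj2 (proj2 subS)))).
Definition sub_one : {x | S x} := exist _ _ (proj1 (proj2 (proj2 (proj2 (proj2 subS))))).
Definition sub_inv (x : {x | S x}) : {x | S x} :=
  exist _ _ (proj1 (proj2 (proj2 (proj2 (proj2 (proj2 subS))))) _ (svalP x)).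
(** [S] is known to be closed only under roots of prime index; the other indices lie outside the
    language and get the identity. *)
Definition sub_root p (x : {x | S x}) : {x | S x} :=
  if pselect (prime p) is left p_pr then
    exist _ _ (proj2 (proj2 (proj2 (proj2 (proj2 (proj2 subS))))) p p_pr _ (svalP x))
  else x.

Definition sub_alg : alg :=
  Alg sub_add sub_mul sub_opp sub_zero sub_one sub_inv sub_root.

Lemma sub_alg_incl : is_hom (sval : sub_alg -> B) /\ injective (sval : sub_alg -> B).
Proof.
split; last by move=> [x Sx] [y Sy] /= xy; apply: eq_exist.
(do 6?split) => //= p p_pr x; rewrite /sub_root.
by case: (pselect (prime p)).
Qed.

End Subalgebras.

Definition pair_alg (A : alg) : alg :=
  @Alg (A * A) (fun x y => (aadd x.1 y.1, aadd x.2 y.2))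
    (fun x y => (amul x.1 y.1, amul x.2 y.2)) (fun x => (aopp x.1, aopp x.2))
    (azero A, azero A) (aone A, aone A) (fun x => (ainv x.1, ainv x.2))
    (fun p x => (aroot p x.1, aroot p x.2)).

Lemma ICM_pair (A : alg) : ICM A -> ICM (pair_alg A).
Proof.
move=> /ICM_embedding [I [F [f [wr hom_f inj_f]]]]; apply/ICM_embedding.
exists (I * bool)%type, (fun i => F i.1), (fun x i => f (if i.2 then x.1 else x.2) i.1).
split => [i||[x1 x2] [y1 y2] xy]; first exact: wr.
  apply/is_hom_prod => -[i c]; have /is_hom_prod/(_ i) := hom_f.
  move=> [fD [fM [fN [f0 [f1 [fV fR]]]]]].
  by do 6?split => *; case: c => /=; rewrite ?fD ?fM ?fN ?f0 ?f1 ?fV ?fR.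
by congr pair; apply: inj_f; apply: functional_extensionality_dep => i;
  [have := congr1 (@^~ (i, true)) xy | have := congr1 (@^~ (i, false)) xy].
Qed.

(** The kernel pair of [f] is a subalgebra of the square of [A], hence in ICM, and [f] identifies
    its two projections. *)
Lemma ICM_mono_injective (A B : alg) (f : A -> B) :
  ICM A -> ICM_mono f -> injective f.
Proof.
move=> icmA [[fD [fM [fN [f0 [f1 [fV fR]]]]]] cancel_f] x y fxy.
pose S (u : pair_alg A) := f u.1 = f u.2.
have subS : is_subuniverse S.
  rewrite /S; (do 6?split) => [u v|u v|u|u|p p_pr u] /=;
  by rewrite ?fD ?fM ?fN ?f0 ?f1 ?fV ?fR //; congruence.
have [hom_val inj_val] := sub_alg_incl subS.
pose C := sub_alg subS.
have hom1 : is_hom (fst : pair_alg A -> A) by do 6?split.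
have hom2 : is_hom (snd : pair_alg A -> A) by do 6?split.
apply: (cancel_f C (fst \o sval) (snd \o sval) _ _ _ _ (exist _ (x, y) fxy)).
- exact: ICM_sub (ICM_pair icmA) hom_val inj_val.
- exact: is_hom_comp hom_val hom1.
- exact: is_hom_comp hom_val hom2.
- by case.
Qed.

(** * The ring of an algebra and separation from a subalgebra *)

(** The alias carries the proofs on which its ring instances rest. *)
Definition alg_ring (B : alg) (_ : ICM B) (_ : aone B <> azero B) : Type := B.

Section AlgRing.
Variables (B : alg) (icmB : ICM B) (nontrivial : aone B <> azero B).
Local Notation R := (alg_ring icmB nontrivial).

HB.instance Definition _ := gen_eqMixin R.
HB.instance Definition _ := gen_choiceMixin R.

(** An algebra of ICM embeds in a product of fields, so identities need only be checked in
    fields. *)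
Let identity (x y : B) :
    (forall (L : fieldType) (f : B -> field_alg L),
      weakly_rooted L -> is_hom f -> f x = f y) -> x = y.
Proof.
have /ICM_embedding [I [F [f [wr /is_hom_prod hom_f inj_f]]]] := icmB.
move=> xy; apply: inj_f; apply: functional_extensionality_dep => i.
by have := xy _ _ (wr i) (hom_f i).
Qed.

Let addA : associative (@aadd B).
Proof.
move=> x y z; apply: identity => L f _ [fD [fM [fN [f0 [f1 [fV fR]]]]]].
by rewrite !fD /= addrA.
Qed.
Let addC : commutative (@aadd B).
Proof.
move=> x y; apply: identity => L f _ [fD [fM [fN [f0 [f1 [fV fR]]]]]].
by rewrite !fD /= addrC.
Qed.
Let add0 : left_id (azero B) (@aadd B).
Proof.
move=> x; apply: identity => L f _ [fD [fM [fN [f0 [f1 [fV fR]]]]]].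
by rewrite !fD f0 /= add0r.
Qed.
Let addN : left_inverse (azero B) (@aopp B) (@aadd B).
Proof.
move=> x; apply: identity => L f _ [fD [fM [fN [f0 [f1 [fV fR]]]]]].
by rewrite !fD fN f0 /= addNr.
Qed.

HB.instance Definition _ := GRing.isZmodule.Build R addA addC add0 addN.

Let mulA : associative (@amul B).
Proof.
move=> x y z; apply: identity => L f _ [fD [fM [fN [f0 [f1 [fV fR]]]]]].
by rewrite !fM /= mulrA.
Qed.
Let mulC : commutative (@amul B).
Proof.
move=> x y; apply: identity => L f _ [fD [fM [fN [f0 [f1 [fV fR]]]]]].
by rewrite !fM /= mulrC.
Qed.
Let mul1 : left_id (aone B) (@amul B).
Proof.
move=> x; apply: identity => L f _ [fD [fM [fN [f0 [f1 [fV fR]]]]]].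
by rewrite !fM f1 /= mul1r.
Qed.
Let mulDl : left_distributive (@amul B) (@aadd B).
Proof.
move=> x y z; apply: identity => L f _ [fD [fM [fN [f0 [f1 [fV fR]]]]]].
by rewrite !(fD, fM) /= mulrDl.
Qed.
Let one_neq0 : (aone B : R) != azero B.
Proof. exact/eqP. Qed.

HB.instance Definition _ :=
  GRing.Zmodule_isComNzRing.Build R mulA mulC mul1 mulDl one_neq0.

Let hom_nat (L : fieldType) (f : B -> field_alg L) m : is_hom f -> f (m%:R : R) = m%:R :> L.
Proof.
move=> [fD [_ [_ [f0 [f1 _]]]]]; elim: m => [|m IHm]; first exact: f0.
by rewrite -[m.+1]addn1 !natrD -IHm [LHS]fD f1.
Qed.

Let hom_exp (L : fieldType) (f : B -> field_alg L) (x : R) m :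
  is_hom f -> f (x ^+ m) = (f x : L) ^+ m.
Proof.
move=> [_ [fM [_ [_ [f1 _]]]]]; elim: m => [|m IHm]; first exact: f1.
by rewrite !exprS -IHm; exact: fM.
Qed.

Definition weak_inv (x : R) : R := @ainv B x.
Definition weak_root p (x : R) : R := @aroot B p x.

Lemma weak_invP (x : R) : x * weak_inv x * x = x.
Proof.
apply: identity => L f _ [fD [fM [fN [f0 [f1 [fV fR]]]]]].
rewrite !fM fV /=; have [->|x0] := eqVneq (f x : L) 0; first by rewrite mulr0.
by rewrite mulfV ?mul1r.
Qed.

Lemma weak_invV (x : R) : weak_inv x * x * weak_inv x = weak_inv x.
Proof.
apply: identity => L f _ [fD [fM [fN [f0 [f1 [fV fR]]]]]].
rewrite !fM !fV /=; have [->|x0] := eqVneq (f x : L) 0; first by rewrite mulr0 mul0r invr0.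
by rewrite mulVf ?mul1r.
Qed.

Lemma weak_root_torsion p (x : R) : prime p -> p%:R * weak_root p x = 0.
Proof.
move=> p_pr; apply: identity => L f _ hom_f.
have [fD [fM [fN [f0 [f1 [fV fR]]]]]] := hom_f.
rewrite fM hom_nat // fR // f0 /= /field_root.
by case: ifP => [/pcharf0 ->|]; rewrite ?mul0r ?mulr0.
Qed.

(* [1 - p p^*] is the indicator of the components of characteristic [p]. *)
Lemma weak_rootX p (x : R) : prime p ->
  weak_root p x ^+ p = (1 - p%:R * weak_inv p%:R) * x.
Proof.
move=> p_pr; apply: identity => L f wr hom_f.
have [fD [fM [fN [f0 [f1 [fV fR]]]]]] := hom_f.
rewrite hom_exp // fR // fM fD fN fM fV f1 hom_nat //=.
have [charp|ncharp] := boolP (p \in [pchar L]).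
  by rewrite field_rootK // (pcharf0 charp) mul0r subr0 mul1r.
have p0 : p%:R != 0 :> L by move: ncharp; rewrite inE p_pr.
by rewrite /field_root (negPf ncharp) mulfV // subrr mul0r expr0n; case: p p_pr {ncharp p0}.
Qed.

(** The four preceding identities between ring expressions pin down the weak inverse and weak roots
    in any field: outside characteristic [p] torsion kills the root, and in characteristic [p] the
    root is unique. *)
Lemma rmorphism_is_hom (L : fieldType) (g : {rmorphism R -> L}) :
  is_hom (g : B -> field_alg L).
Proof.
(do 6?split) => [x y|x y|x|||x|p p_pr x].
- exact: (rmorphD g).
- exact: (rmorphM g).
- exact: (rmorphN g).
- exact: (rmorph0 g).
- exact: (rmorph1 g).
- have gP := congr1 g (weak_invP x); have gV := congr1 g (weak_invV x).
  rewrite !rmorphM in gP gV; change (g (weak_inv x) = (g x)^-1).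
  have [gx0|gx0] := eqVneq (g x) 0; first by rewrite gx0 invr0 -gV gx0 mulr0 mul0r.
  apply: (mulfI gx0); rewrite mulfV //; apply: (mulIf gx0).
  by rewrite gP mul1r.
- have gT := congr1 g (weak_root_torsion x p_pr); have gX := congr1 g (weak_rootX x p_pr).
  rewrite !rmorphM rmorph_nat rmorph0 in gT.
  rewrite rmorphXn rmorphM rmorphB rmorph1 rmorphM rmorph_nat in gX.
  change (g (weak_root p x) = field_root p (g x)).
  have [charp|ncharp] := boolP (p \in [pchar L]).
    symmetry; apply: (field_root_unique charp).
    by rewrite gX (pcharf0 charp) mul0r subr0 mul1r.
  have p0 : p%:R != 0 :> L by move: ncharp; rewrite inE p_pr.
  by rewrite /field_root (negPf ncharp); apply: (mulfI p0); rewrite gT mulr0.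
Qed.

Variable S : B -> Prop.
Hypothesis subS : is_subuniverse S.

Lemma subuniverse_subring : subring_set (S : set R).
Proof.
have [SD [SM [SN [S0 [S1 _]]]]] := subS; split => // x y Sx Sy.
by apply: SD => //; apply: SN.
Qed.

Lemma subuniverse_separation (b : B) : ~ S b ->
  exists (L : fieldType) (g h : B -> field_alg L),
    [/\ weakly_rooted L, is_hom g, is_hom h, forall a, S a -> g a = h a & g b <> h b].
Proof.
move=> nSb; have subring := subuniverse_subring.
have [SD [SM [SN [S0 [S1 [SV SR]]]]]] := subS.
have SB (x y : R) : S x -> S y -> S (x - y) by case: subring => _ + _; apply.
have subT : subring_set (setT : set R) by split.
pose b' : R := b.
(* [N] is an ideal maximal with [b] outside [S + N]; the zero ideal qualifies because [b] is outside
   [S]. *)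
have [||N [[N0 ND NM] _ NY maxN]] := @maximal_submod_avoiding R setT subT
    [set 0]%classic [set x | S (b' - x)]%classic.
- by split => [//|x y /= -> ->|a x _ /= ->]; rewrite ?addr0 ?mulr0.
- by move=> x /= ->; rewrite subr0.
have NN x : N x -> N (- x) by rewrite -mulN1r; apply: NM.
have N1 : ~ N 1.
  by move=> N1; apply: (NY b'); [rewrite -[b']mulr1; apply: NM|rewrite /= subrr].
have [Q [pi [pi_surj piE]]] := @ideal_quotient R N (And3 N0 ND NM) N1.
pose K : set Q := [set k | exists s : R, S s /\ k = pi s]%classic.
have subK : subring_set K.
  split; first by exists 1; split; rewrite ?rmorph1.
  - move=> _ _ [s [Ss ->]] [t [St ->]]; exists (s - t).
    by split; [exact: SB|rewrite rmorphB].
  - move=> _ _ [s [Ss ->]] [t [St ->]]; exists (s * t).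
    by split; [exact: SM|rewrite rmorphM].
have fieldK : subfield_set K.
  split => // _ [s [Ss ->]] s_neq0; exists (pi (weak_inv s)).
    by exists (weak_inv s); split => //; apply: SV.
  (* The idempotent [e] generates the same ideal as [s], so it is outside [N]; inverting [pi s]
     means showing [e = 1] modulo [N]. *)
  pose e := s * weak_inv s.
  have se : e * s = s by exact: weak_invP.
  have ee : e * e = e by rewrite {2}/e mulrA se.
  have Se : S e by apply: SM => //; apply: SV.
  have nNe : ~ N e.
    by move=> Ne; case/eqP: s_neq0; apply/piE; rewrite -se mulrC; apply: NM.
  have [a [w [_ Nw Sw]]] := maxN _ nNe.
  (* [b] cannot lie in [S + N] on both [e] and [1 - e], so [N] contains [1 - e]. *)
  suff N1e : N (1 - e).
    apply/eqP; rewrite eq_sym -subr_eq0 -rmorphM -[1](rmorph1 pi) -rmorphB.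
    by apply/eqP/piE.
  apply: contrapT => /maxN [a' [w' [_ Nw' Sw']]].
  apply: (NY ((1 - e) * w + e * w')); first by apply: ND; apply: NM.
  (* The terms [a * e] and [a' * (1 - e)] are killed by the complementary idempotents, so the two
     memberships in [S] glue. *)
  rewrite /=; have -> : b' - ((1 - e) * w + e * w') =
      (1 - e) * (b' - (w + a * e)) + e * (b' - (w' + a' * (1 - e))).
    by ring: ee.
  by apply: SD; apply: SM => //; apply: SB.
have charN p : p \in [pchar Q] -> N p%:R.
  by move=> charp; apply/piE; rewrite rmorph_nat (pcharf0 charp).
(* In characteristic [p] the indicator in [weak_rootX] maps to [1], so weak roots become true
   roots. *)
have pi_root p (x : R) : p \in [pchar Q] -> pi (weak_root p x) ^+ p = pi x.
  move=> charp; rewrite -rmorphXn weak_rootX ?(pcharf_prime charp) //.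
  by rewrite rmorphM rmorphB rmorph1 rmorphM rmorph_nat (pcharf0 charp) mul0r subr0 mul1r.
have [|p charp x|p charp _ [s [Ss ->]]||L [g [h [wr gh gb]]]] :=
    @subfield_separation Q K (pi b') fieldK.
(* By von Neumann regularity [y] is a multiple of [y ^+ 2]. *)
- move=> x; have [y <-] := pi_surj x; rewrite -rmorphXn => /piE Nyy.
  by apply/piE; rewrite -(weak_invP y) mulrAC mulrC -expr2; apply: NM.
- by have [y <-] := pi_surj x; exists (pi (weak_root p y)); exact: pi_root.
- exists (pi (weak_root p s)); last exact: pi_root.
  by exists (weak_root p s); split => //; apply: SR => //; exact: pcharf_prime charp.
(* If [pi b = pi s], then [b - s] is in [N], yet [b - (b - s) = s] is in [S]. *)
- move=> [s [Ss /eqP]]; rewrite -subr_eq0 -rmorphB => /eqP/piE/NY.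
  by apply; rewrite /= opprB addrC subrK.
exists L, (g \o pi : {rmorphism R -> L}), (h \o pi : {rmorphism R -> L}).
split => //; try exact: rmorphism_is_hom.
- by move=> a Sa; apply: gh; exists a.
- exact/eqP.
Qed.

End AlgRing.

(** * Equalizers and dominions *)

Lemma ICM_subuniverse_equalizer (B : alg) (S : B -> Prop) :
    ICM B -> is_subuniverse S ->
  exists (D : alg) (u v : B -> D),
    [/\ ICM D, is_hom u, is_hom v & forall b, u b = v b <-> S b].
Proof.
move=> icmB subS.
have sep (i : {b | ~ S b}) :
  exists w : {L : fieldType & (B -> field_alg L) * (B -> field_alg L)}%type,
    [/\ weakly_rooted (projT1 w), is_hom (projT2 w).1, is_hom (projT2 w).2,
      forall a, S a -> (projT2 w).1 a = (projT2 w).2 a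
    & (projT2 w).1 (sval i) <> (projT2 w).2 (sval i)].
  case: i => b nSb /=.
  (* If [1 = 0], the product in which [B] embeds has no factors, so [b = 0] would lie in [S]. *)
  have nontrivial : aone B <> azero B.
    move=> one0; apply: nSb; have [_ [_ [_ [S0 _]]]] := subS.
    suff -> : b = azero B by [].
    have /ICM_embedding [I [F [f [_ hom_f inj_f]]]] := icmB.
    have [_ [_ [_ [f0 [f1 _]]]]] := hom_f.
    apply: inj_f; apply: functional_extensionality_dep => i.
    have /eqP := congr1 (@^~ i) (etrans (esym f1) (etrans (congr1 f one0) f0)).
    by rewrite /= oner_eq0.
  have [L [g [h gh]]] := @subuniverse_separation B icmB nontrivial S subS b nSb.
  by exists (existT _ L (g, h)).
have [w wP] := choice sep.
exists (prod_alg (fun i => projT1 (w i))), (fun b i => (projT2 (w i)).1 b),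
  (fun b i => (projT2 (w i)).2 b); split.
- by apply: ICM_prod => i; case: (wP i).
- by apply/is_hom_prod => i; case: (wP i).
- by apply/is_hom_prod => i; case: (wP i).
move=> b; split => [uv|Sb].
  apply: contrapT => nSb; case: (wP (exist _ b nSb)) => _ _ _ _; apply => /=.
  exact: (congr1 (@^~ (exist _ b nSb)) uv).
by apply: functional_extensionality_dep => i; case: (wP i) => _ _ _ agree _; exact: agree.
Qed.

Theorem mainTheorem3 :
  (forall (A B : alg) (f : A -> B), ICM A -> ICM B ->
     ICM_mono f -> ICM_regular_mono f) /\
  (forall (B : alg) (S : B -> Prop), ICM B -> is_subuniverse S ->
     forall b : B, ICM_dominion S b <-> S b).
Proof.
split => [A B f icmA icmB monof|B S icmB subS b]; last first.
  split => [dom|Sb C g h _ _ _ gh]; last exact: gh.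
  have [D [u [v [icmD hom_u hom_v uv]]]] := ICM_subuniverse_equalizer icmB subS.
  by apply/uv/dom => // a /uv.
have inj_f := ICM_mono_injective icmA monof; case: (monof) => hom_f _.
split => //; have [fD [fM [fN [f0 [f1 [fV fR]]]]]] := hom_f.
(* The image of [f] is the set where [u] and [v] agree, so any [g] equalized by them lifts along the
   injective [f]. *)
pose S y := exists x, f x = y.
have subS : is_subuniverse S.
  do 6?split.
  - by move=> _ _ [x <-] [y <-]; exists (aadd x y).
  - by move=> _ _ [x <-] [y <-]; exists (amul x y).
  - by move=> _ [x <-]; exists (aopp x).
  - by exists (azero A).
  - by exists (aone A).
  - by move=> _ [x <-]; exists (ainv x).
  - by move=> p p_pr _ [x <-]; exists (aroot p x); rewrite fR.
have [D [u [v [icmD hom_u hom_v uv]]]] := ICM_subuniverse_equalizer icmB subS.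
exists D, u, v; do 3?split => //; split => [a|C g icmC hom_g ugvg].
  by apply/uv; exists a.
have im_g c : exists x, f x = g c by apply/uv.
have [k fk] := choice im_g.
have [gD [gM [gN [g0 [g1 [gV gR]]]]]] := hom_g.
exists k; split => // [|k' _ fk' c]; last by apply: inj_f; rewrite fk fk'.
do 6?split.
- by move=> x y; apply: inj_f; rewrite fD !fk.
- by move=> x y; apply: inj_f; rewrite fM !fk.
- by move=> x; apply: inj_f; rewrite fN !fk.
- by apply: inj_f; rewrite f0 fk.
- by apply: inj_f; rewrite f1 fk.
- by move=> x; apply: inj_f; rewrite fV !fk.
- by move=> p p_pr x; apply: inj_f; rewrite fR // !fk gR.
Qed.
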